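(* The naive Bayes model with $r$ classes and $n$ features with $d_1,\dots,d_n$ levels corresponds to the $r$-th secant variety of a Segre product of $n$ projective spaces: $$\overline{\pi(V(P_G))}\;=\;\mathrm{Sec}^r(X_{d_1,d_2,\dots,d_n}).$$
   Context: Let $G$ be the acyclic directed graph with $n+1$ nodes $F_1,\dots,F_n,H$ and the $n$ directed edges from $H$ to $F_i$, $i=1,\dots,n$ (the naive Bayes model). The random variable $F_i$ (a feature) has values in $[d_i]=\{1,\dots,d_i\}$; the hidden variable $H$ has values in $[r]$ (the classes). Put $D=[d_1]\times\cdots\times[d_n]\times[r]$ and $D'=[d_1]\times\cdots\times[d_n]$. $\mathbb{R}[D]$ is the polynomial ring in unknowns $p_{i_1\cdots i_nk}$. The ideal $P_G\subset\mathbb{R}[D]$ is the ideal of complete independence of $F_1,\dots,F_n$ given $H$: it is the sum over $k\in[r]$ of the ideals $P_k$, where $P_k$ is generated by the kernel of the ring map $p_{i_1\cdots i_nk}\mapsto x^{(1)}_{i_1}x^{(2)}_{i_2}\cdots x^{(n)}_{i_n}$ (with independent unknowns $x^{(j)}_i$, $i\in[d_j]$) on the polynomial ring in the $p_{i_1\cdots i_nk}$ with $k$ fixed. $V(P_G)\subset\mathbb{R}^D$ is its zero set. The linear map $\pi:\mathbb{R}^D\to\mathbb{R}^{D'}$ sends a table $(p_{i_1\cdots i_nk})$ to $\bigl(\sum_{k=1}^rp_{i_1\cdots i_nk}\bigr)$, and the overline denotes Zariski closure. $X_{d_1,\dots,d_n}=\mathbb{P}^{d_1-1}\times\cdots\times\mathbb{P}^{d_n-1}\subset\mathbb{P}^{d_1\cdots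 d_n-1}$ is the Segre variety, whose points are the tensors of rank $\le 1$ (rank one up to scaling). $\mathrm{Sec}^r(X)$ is the $r$-th higher secant variety, i.e. the Zariski closure of the union of the linear spans of $r$ points of $X$ (so $\mathrm{Sec}^1(X)=X$); a projective variety in $\mathbb{P}^{d_1\cdots d_n-1}$ is identified with its affine cone in $\mathbb{R}^{D'}$. *)

(* Defs.v *)
From HB Require Import structures.
From mathcomp Require Import all_boot all_order all_algebra.
From mathcomp Require Import classical_sets reals.
From mathcomp Require Import mpoly.

Set Implicit Arguments.
Unset Strict Implicit.
Unset Printing Implicit Defensive.

Import GRing.Theory.
Local Open Scope classical_set_scope.
Local Open Scope ring_scope.

(* The space R^I; [R^o] gives access to the vector space structure. *)
Notation table R I := {ffun I -> R^o}.

(* R[I]: the unknown of index [i : I] is the one of rank [enum_rank i]. *)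
Notation polyring R I := {mpoly R[#|{: I}|]}.

Definition unknown (R : realType) (I : finType) (i : I) : polyring R I :=
  'X_(enum_rank i).

Definition peval (R : realType) (I : finType) (v : table R I)
  (f : polyring R I) : R := f.@[fun a => v (enum_val a)].

(* The R-algebra map R[I] -> R[J] sending the unknown of index i to [g i]. *)
Definition psubst (R : realType) (I J : finType) (g : I -> polyring R J)
  (f : polyring R I) : polyring R J :=
  mmap (@mpolyC #|{: J}| R) (fun a => g (enum_val a)) f.

Definition ideal_gen (A : comNzRingType) (S : set A) : set A :=
  [set f | exists m (h g : 'I_m -> A),
     (forall a, S (g a)) /\ f = \sum_(a < m) h a * g a].

Definition ideal_sum (A : comNzRingType) (r : nat) (P : 'I_r -> set A) : set A :=
  [set f | exists g : 'I_r -> A,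
     (forall k, P k (g k)) /\ f = \sum_(k < r) g k].

Definition zero_set (R : realType) (I : finType) (S : set (polyring R I)) :
    set (table R I) :=
  [set v | forall f, S f -> peval v f = 0].

Definition vanishing (R : realType) (I : finType) (S : set (table R I)) :
    set (polyring R I) :=
  [set f | forall v, S v -> peval v f = 0].

Definition zariski_closure (R : realType) (I : finType) (S : set (table R I)) :
    set (table R I) :=
  zero_set (vanishing S).

(* Subsets of the projective space of R^I are represented by their affine
   cones in R^I, with the origin included.  The closed subsets of the
   projective space are cut out by homogeneous polynomials. *)
Definition proj_zariski_closure (R : realType) (I : finType)
    (S : set (table R I)) : set (table R I) :=
  zero_set [set f | vanishing S f /\ exists m : nat, f \is m.-homog].

(* Repetitions among the r points are allowed; since the origin belongs to the
   cone [X], so are spans of fewer points. *)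
Definition secant_variety (R : realType) (I : finType) (r : nat)
    (X : set (table R I)) : set (table R I) :=
  proj_zariski_closure
    [set v | exists x : r.-tuple (table R I),
       (forall k : 'I_r, X (tnth x k)) /\ v \in <<x>>%VS].

Section NaiveBayes.
Variables (R : realType) (n r : nat) (d : 'I_n -> nat).

(* D' and D; levels and classes are numbered from 0. *)
Definition obs : finType := {dffun forall j : 'I_n, 'I_(d j)}.
Definition full : finType := (obs * 'I_r)%type.

(* Index set of the unknowns x^(j)_i, with i a level of feature j. *)
Definition par : finType := {j : 'I_n & 'I_(d j)}.

(* p_i |-> x^(1)_(i 1) ... x^(n)_(i n) *)
Definition monomial_map : polyring R obs -> polyring R par :=
  psubst (fun i : obs =>
    \prod_(j < n) unknown R (Tagged (fun j : 'I_n => 'I_(d j)) (i j) : par)).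

(* R[D'] is identified with the subring of R[D] in the unknowns p_(i, k),
   with k fixed. *)
Definition class_embed (k : 'I_r) : polyring R obs -> polyring R full :=
  psubst (fun i : obs => unknown R ((i, k) : full)).

Definition P_class (k : 'I_r) : set (polyring R full) :=
  ideal_gen [set class_embed k f | f in [set f | monomial_map f = 0]].

Definition P_G : set (polyring R full) := ideal_sum P_class.

Definition marginal (p : table R full) : table R obs :=
  [ffun i : obs => \sum_(k < r) p (i, k)].

(* The affine cone of the Segre variety: tensors of rank at most one. *)
Definition segre : set (table R obs) :=
  [set t | exists u : forall j : 'I_n, 'I_(d j) -> R,
     forall i : obs, t i = \prod_(j < n) u j (i j)].

End NaiveBayes.

Arguments P_G R {n} r d.
Arguments marginal {R n r d}.
Arguments segre R {n} d.

(* Main.v *)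
Require Import Defs.
From HB Require Import structures.
From mathcomp Require Import all_boot all_order all_algebra.
From mathcomp Require Import classical_sets reals.
From mathcomp Require Import mpoly.

(** Both sides are Zariski closures of one and the same cone, the set of sums
    of [r] tensors of rank at most one.

    On the left, [P_G] constrains the classes separately, so a table is a zero
    of [P_G] exactly when each of its [r] slices is a common zero of the kernel
    of the monomial parametrization ([zero_set_P_G]).  The common real zeros of
    that kernel are exactly the tensors of rank at most one
    ([zero_set_kernel]), although a parametrized set need not be closed in
    general: if [t] is a nonzero zero and [t i0 != 0], the kernel contains the
    binomial [p_i p_i0 ^ (n-1) - \prod_j p_(i0 with entry j of i)], which
    expresses [t i] as a product of functions of the single entries of [i].
    Marginalization adds the slices ([marginal_zero_set_P_G]).

    On the right, a tensor of rank at most one remains so under scaling, so the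
    spans of [r] such tensors are filled by the sums of [r] of them
    ([span_segre]).

    The closure on the left is cut out by all vanishing polynomials, the one on
    the right only by the homogeneous ones.  They agree on a cone, because the
    homogeneous components of a polynomial vanishing on a cone also vanish on
    it, the field being infinite ([proj_zariski_closure_cone]). *)

Local Open Scope classical_set_scope.
Local Open Scope ring_scope.
Import GRing.Theory Num.Theory.

(** * Evaluation and substitution *)

HB.instance Definition _ (R : realType) (I : finType) (v : table R I) :=
  GRing.RMorphism.copy (peval v) (meval (fun a => v (enum_val a))).

HB.instance Definition _ (R : realType) (I J : finType)
    (g : I -> polyring R J) :=
  GRing.RMorphism.copy (psubst g)
    (mmap (@mpolyC #|{: J}| R) (fun a => g (enum_val a))).

Lemma peval_unknown (R : realType) (I : finType) (v : table R I) (i : I) :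
  peval v (unknown R i) = v i.
Proof. by rewrite /peval mevalXU enum_rankK. Qed.

Lemma peval_psubst (R : realType) (I J : finType) (g : I -> polyring R J)
    (w : table R J) (f : polyring R I) :
  peval w (psubst g f) = peval [ffun i => peval w (g i)] f.
Proof.
rewrite /peval /psubst /mmap raddf_sum mevalE; apply: eq_bigr => m _ /=.
rewrite mevalM mevalC; congr (_ * _); rewrite rmorph_prod.
by apply: eq_bigr => a _; rewrite rmorphXn ffunE.
Qed.

Lemma psubst_unknown (R : realType) (I J : finType) (g : I -> polyring R J)
    (i : I) :
  psubst g (unknown R i) = g i.
Proof. by rewrite /psubst mmapX mmap1U enum_rankK. Qed.

Lemma peval_homog (R : realType) (I : finType) (v : table R I) (c : R) (m : nat)
    (f : polyring R I) :
  f \is m.-homog -> peval (c *: v) f = c ^+ m * peval v f.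
Proof.
move=> /dhomogP fm; rewrite /peval !mevalE mulr_sumr big_seq [RHS]big_seq.
apply: eq_bigr => e /fm <-; rewrite mulrCA; congr (_ * _).
rewrite /= mdegE -prodrXr -big_split /=; apply: eq_bigr => a _.
by rewrite ffunE exprMn.
Qed.

(** * Closures of cones *)

Lemma poly_eq0_horner (R : realType) (p : {poly R}) :
  (forall c, p.[c] = 0) -> p = 0.
Proof.
move=> p0; apply/eqP/negPn/negP => p_neq0.
have := max_poly_roots p_neq0 (rs := [seq i%:R | i <- iota 0 (size p)]).
rewrite size_map size_iota ltnn => h; suff: false by []; apply: h.
  by apply/allP => c _; apply/rootP.
by rewrite map_inj_uniq ?iota_uniq // => i j /eqP; rewrite eqr_nat => /eqP.
Qed.

(** Along the line through [v], the values of [f] form a univariate polynomial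
    whose coefficients are the values at [v] of the components of [f]; it
    vanishes identically when [f] does so on a cone. *)
Lemma vanishing_cone (R : realType) (I : finType) (S : set (table R I))
    (f : polyring R I) (m : nat) :
  (forall c v, S v -> S (c *: v)) ->
  vanishing S f -> vanishing S (pihomog mdeg m f).
Proof.
move=> coneS f0 v Sv.
(* [m.+1] makes room for coefficient [m] even beyond the degree of [f]. *)
set k := maxn (msize f) m.+1.
pose q := \poly_(e < k) peval v (pihomog mdeg e f).
suff q0 : q = 0.
  by have := coef_poly k (fun e => peval v (pihomog mdeg e f)) m;
     rewrite -/q q0 coef0 leq_maxr.
apply: poly_eq0_horner => c; rewrite horner_poly -[RHS](f0 _ (coneS c v Sv)).
rewrite [f in RHS](pihomog_partitionE (mf := mdeg) (k := k)) ?leq_maxl //.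
rewrite raddf_sum; apply: eq_bigr => e _.
by rewrite mulrC -peval_homog ?pihomogP.
Qed.

Lemma proj_zariski_closure_cone (R : realType) (I : finType)
    (S : set (table R I)) :
  (forall c v, S v -> S (c *: v)) ->
  proj_zariski_closure S = zariski_closure S.
Proof.
move=> coneS; apply/seteqP; split=> v vS f fS.
  rewrite (pihomog_partitionE (mf := mdeg) (leqnn (msize f))).
  rewrite raddf_sum big1 // => e _; apply: vS; split.
    exact: vanishing_cone.
  by exists (val e); apply: pihomogP.
by apply: vS; case: fS.
Qed.

(** * Tensors of rank at most one *)

Section Segre.
Variables (R : realType) (n : nat) (d : 'I_n -> nat).

Definition change_entry (i0 : obs d) {j : 'I_n} (a : 'I_(d j)) : obs d :=
  [ffun l => dfwith i0 a l].

(** Each feature occurs [n] times on the right: once with its entry in [i], at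
    the factor where it is the changed one, and [n-1] times with its entry
    in [i0]. *)
Lemma prod_change_entry {A : comPzRingType} (y : forall j, 'I_(d j) -> A)
    (i0 i : obs d) :
  (\prod_(j < n) y j (i j)) * (\prod_(j < n) y j (i0 j)) ^+ n.-1 =
  \prod_(j < n) \prod_(l < n) y l (change_entry i0 (i j) l).
Proof.
rewrite exchange_big -prodrXl -big_split; apply: eq_bigr => l _ /=.
rewrite (bigD1 l) //= ffunE dfwith_in; congr (_ * _).
rewrite (eq_bigr (fun=> y l (i0 l))) => [|j jl]; last first.
  by rewrite ffunE dfwith_out.
by rewrite prodr_const cardC1 card_ord.
Qed.

Definition segre_binomial (i0 i : obs d) : polyring R (obs d) :=
  unknown R i * unknown R i0 ^+ n.-1 -
  \prod_(j < n) unknown R (change_entry i0 (i j)).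

Lemma monomial_map_segre_binomial (i0 i : obs d) :
  monomial_map (segre_binomial i0 i) = 0.
Proof.
rewrite /monomial_map rmorphB rmorphM rmorphXn rmorph_prod /= !psubst_unknown.
rewrite (prod_change_entry (fun j a => unknown R (Tagged _ a : par d))).
apply/eqP; rewrite subr_eq0; apply/eqP; apply: eq_bigr => j _.
by rewrite psubst_unknown.
Qed.

(** The monomial map is the pullback of polynomials along the parametrization
    [u |-> (i |-> \prod_j u_j (i_j))]. *)
Lemma peval_segre (u : forall j, 'I_(d j) -> R) (f : polyring R (obs d)) :
  peval [ffun i : obs d => \prod_(j < n) u j (i j)] f =
  peval [ffun x : par d => u (tag x) (tagged x)] (monomial_map f).
Proof.
rewrite peval_psubst; congr (peval _ _); apply/ffunP => i.
rewrite !ffunE rmorph_prod; apply: eq_bigr => j _ /=.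
by rewrite peval_unknown ffunE.
Qed.

(** At a zero [t] with [t i0 != 0], the binomials say that
    [t i * t i0 ^ (n-1)] is the product over [j] of the values of [t] at [i0]
    with entry [j] replaced by that of [i]; dividing by [t i0 ^ (n-1)] gives
    the factorization.  The zero tensor is the product of zero factors, of
    which there is at least one. *)
Lemma zero_set_kernel : (0 < n)%N ->
  zero_set [set f | @monomial_map R n d f = 0] = segre R d.
Proof.
move=> n_gt0; pose j0 := Ordinal n_gt0; apply/seteqP; split=> t.
  move=> t0; case: (altP (t =P 0)) => [->|].
    exists (fun _ _ => 0) => i; rewrite ffunE; apply/esym/eqP/prodf_eq0.
    by exists j0.
  move=> t_neq0; have [i0 ti0] : exists i0, t i0 != 0.
    apply/existsP; move: t_neq0; apply: contraNT; rewrite negb_exists.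
    by move=> /forallP h; apply/eqP/ffunP => i; rewrite ffunE; apply/eqP/negPn.
  (* [n] factors against [n-1] denominators: the feature [j0] gets none. *)
  exists (fun j a => t (change_entry i0 a) / (if j == j0 then 1 else t i0)).
  move=> i; have := t0 _ (monomial_map_segre_binomial i0 i).
  rewrite rmorphB rmorphM rmorphXn rmorph_prod /= !peval_unknown => /eqP.
  rewrite subr_eq0 => /eqP e.
  rewrite prodf_div [X in _ / X](_ : _ = t i0 ^+ n.-1); last first.
    rewrite (bigD1 j0) //= mul1r (eq_bigr (fun=> t i0)).
      by rewrite prodr_const cardC1 card_ord.
    by move=> j /negPf ->.
  rewrite (eq_bigr (fun j => peval t (unknown R (change_entry i0 (i j))))).
    by rewrite -e mulfK // expf_neq0.
  by move=> j _; rewrite peval_unknown.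
move=> [u tu] f f0.
have -> : t = [ffun i : obs d => \prod_(j < n) u j (i j)].
  by apply/ffunP => i; rewrite ffunE.
by rewrite peval_segre f0 rmorph0.
Qed.

Lemma segreZ (c : R) (t : table R (obs d)) :
  (0 < n)%N -> segre R d t -> segre R d (c *: t).
Proof.
move=> n_gt0 [u tu]; pose j0 := Ordinal n_gt0.
exists (fun j a => (if j == j0 then c else 1) * u j a) => i.
rewrite ffunE tu big_split; congr (_ * _).
rewrite (bigD1 j0) //= big1 ?mulr1 //.
by move=> j /negPf ->.
Qed.

(** * Mixtures of r classes *)

Variable r : nat.

Definition segre_sums : set (table R (obs d)) :=
  [set v | exists x : 'I_r -> table R (obs d),
     (forall k, segre R d (x k)) /\ v = \sum_(k < r) x k].

Definition slice (k : 'I_r) (p : table R (full r d)) : table R (obs d) :=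
  [ffun i => p (i, k)].

Lemma peval_class_embed (k : 'I_r) (p : table R (full r d))
    (f : polyring R (obs d)) :
  peval p (class_embed k f) = peval (slice k p) f.
Proof.
rewrite peval_psubst; congr (peval _ _); apply/ffunP => i.
by rewrite !ffunE peval_unknown.
Qed.

Lemma zero_set_P_G : (0 < n)%N ->
  zero_set (P_G R r d) = [set p | forall k, segre R d (slice k p)].
Proof.
move=> n_gt0; rewrite -zero_set_kernel //; apply/seteqP; split=> p hp.
  move=> k f f0; rewrite -peval_class_embed; apply: hp.
  exists (fun l => if l == k then class_embed k f else 0); split.
    move=> l; case: eqP => [->|_].
      exists 1%N, (fun=> 1), (fun=> class_embed k f); split.
        by move=> _; exists f.
      by rewrite big_ord1 mul1r.
    by exists 0%N, (fun=> 0), (fun=> 0); split=> [[]|] //; rewrite big_ord0.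
  by rewrite -big_mkcond big_pred1_eq.
move=> f [g [gP ->]]; rewrite rmorph_sum big1 //= => k _.
have [m [h [b [bP ->]]]] := gP k; rewrite rmorph_sum big1 //= => a _.
rewrite rmorphM /=; have [e e0 <-] := bP a.
by rewrite peval_class_embed (hp k e e0) mulr0.
Qed.

Lemma marginal_zero_set_P_G : (0 < n)%N ->
  marginal @` zero_set (P_G R r d) = segre_sums.
Proof.
move=> n_gt0; rewrite zero_set_P_G //; apply/seteqP; split=> v.
  move=> [p hp <-]; exists (slice^~ p); split=> //.
  apply/ffunP => i; rewrite sum_ffunE ffunE.
  by apply: eq_bigr => k _; rewrite ffunE.
move=> [x [hx ->]]; exists [ffun ik : full r d => x ik.2 ik.1].
  move=> k; rewrite (_ : slice k _ = x k) //.
  by apply/ffunP => i; rewrite !ffunE.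
apply/ffunP => i; rewrite sum_ffunE ffunE.
by apply: eq_bigr => k _; rewrite ffunE.
Qed.

(** The coefficients of a linear combination are absorbed into its [r]
    tensors. *)
Lemma span_segre : (0 < n)%N ->
  [set v | exists x : r.-tuple (table R (obs d)),
     (forall k : 'I_r, segre R d (tnth x k)) /\ v \in <<x>>%VS] = segre_sums.
Proof.
move=> n_gt0; apply/seteqP; split=> v.
  move=> [x [hx vx]]; exists (fun k => coord x k v *: x`_k); split.
    by move=> k; apply: segreZ; rewrite // -tnth_nth.
  exact: coord_span.
move=> [x [hx ->]]; exists [tuple x k | k < r]; split.
  by move=> k; rewrite tnth_mktuple.
apply: memv_suml => k _; apply: memv_span; apply/tnthP; exists k.
by rewrite tnth_mktuple.
Qed.

Lemma segre_sumsZ (c : R) (v : table R (obs d)) :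
  (0 < n)%N -> segre_sums v -> segre_sums (c *: v).
Proof.
move=> n_gt0 [x [hx ->]]; exists (fun k => c *: x k); split.
  by move=> k; apply: segreZ.
by rewrite scaler_sumr.
Qed.

End Segre.

Theorem corollary20 (R : realType) (n r : nat) (d : 'I_n -> nat)
    (n_gt0 : (0 < n)%N) (r_gt0 : (0 < r)%N) (d_gt0 : forall j, (0 < d j)%N) :
  zariski_closure (marginal @` zero_set (P_G R r d))
  = secant_variety r (segre R d).
Proof.
rewrite marginal_zero_set_P_G // /secant_variety span_segre //.
by rewrite proj_zariski_closure_cone // => c v; apply: segre_sumsZ.
Qed.
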